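(* For $\lambda\in(0,1)$ and $r\in[-1,1]\setminus\{0\}$, define $f_{r,\lambda}(x)=[1-\lambda+\lambda x^r]^{1/r}$. Let $T=U|T|\in\mathcal{M}_m(\mathbb{C})$ be the polar decomposition of an invertible centered matrix. If $U=V^*\,\mathrm{diag}(\alpha_1,\dots,\alpha_m)\,V$ with $V$ unitary and $\alpha_i\ne\alpha_j$ for $i\ne j$, then $$\lim_{n\to\infty}\Delta_{f_{r,\lambda}}^n(T)=U\bigl[V^*\bigl(I\circ V|T|^rV^*\bigr)V\bigr]^{1/r},$$ where $X\circ Y$ denotes the Hadamard (entrywise) product of matrices $X$ and $Y$. Especially, if $r=1$, the assumption that $T$ is centered can be removed.
   Context: $\mathcal{M}_m(\mathbb{C})$ is the set of $m\times m$ complex matrices, $|T|=(T^*T)^{1/2}$; for invertible $T$ the factor $U$ in $T=U|T|$ is unitary. The functions $f=f_{r,\lambda}$ are representing functions of operator means (power means). Induced Aluthge transformation of an invertible matrix $T=U|T|$ with $|T|=\sum_i s_iE_i$ ($s_i$ distinct eigenvalues, $E_i$ spectral projections): $\Delta_f(T)=\sum_{i,j}s_i f(s_j/s_i)\,E_iUE_j$. For $r=1$ this is $(1-\lambda)|T|U+\lambda U|T|$. Iterates: $\Delta_f^0(T)=T$, $\Delta_f^n(T)=\Delta_f(\Delta_f^{n-1}(T))$. $T=U|T|$ is centered if $\{U^{*m}|T|U^m,\ |T|,\ U^n|T|U^{*n}: n,m=1,2,\dots\}$ is a commuting set. *)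

(* Defs.v *)
From HB Require Import structures.
From mathcomp Require Import all_boot all_order all_algebra.
From mathcomp Require Import sesquilinear spectral.
From mathcomp Require Import complex.
From mathcomp Require Import all_classical all_reals all_analysis.

Set Implicit Arguments.
Unset Strict Implicit.
Unset Printing Implicit Defensive.

Import Order.TTheory GRing.Theory Num.Theory numFieldNormedType.Exports.

Local Open Scope classical_set_scope.
Local Open Scope ring_scope.
Local Open Scope sesquilinear_scope.
Local Open Scope complex_scope.

(* The usual topology of the complex numbers: MathComp-Analysis provides it for
   abstract numClosedFieldTypes only; it induces the one of 'M[R[i]]_m. *)
HB.instance Definition _ (R : realType) :=
  NormedModule.copy R[i] (R[i] : numClosedFieldType)^o.

Section InducedAluthge.
Variables (R : realType) (m : nat).
Implicit Types (A B T : 'M[R[i]]_m) (f : R -> R).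

(* The distinct eigenvalues of a normal matrix. *)
Definition spectrum A : seq R[i] :=
  undup [seq spectral_diag A ord0 i | i : 'I_m].

(* [eigenspace A s] consists of the rows u with u *m A = s *: u. For A
   Hermitian, these are the conjugate transposes of the column eigenvectors,
   and the orthogonal projection onto them (acting on rows on the right) is a
   Hermitian matrix, so that it also is, acting on columns on the left, the
   orthogonal projection onto the column eigenspace. *)
Definition spectral_proj A (s : R[i]) : 'M[R[i]]_m :=
  proj_ortho (eigenspace A s).

(* Functional calculus; meaningful for A Hermitian, whose eigenvalues are
   real. *)
Definition funmx f A : 'M[R[i]]_m :=
  \sum_(s <- spectrum A) (f (complex.Re s))%:C *: spectral_proj A s.

(* Real powers of a positive semidefinite matrix. *)
Definition powmx A (r : R) : 'M[R[i]]_m := funmx (fun x => x `^ r) A.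

Definition absmx T : 'M[R[i]]_m := powmx (T ^t* *m T) 2^-1.

(* The factor U of T = U |T|, for T invertible. *)
Definition polar_unitary T : 'M[R[i]]_m := T *m invmx (absmx T).

Definition aluthge f T : 'M[R[i]]_m :=
  let A := absmx T in
  \sum_(s <- spectrum A) \sum_(t <- spectrum A)
    (complex.Re s * f (complex.Re t / complex.Re s))%:C *:
      (spectral_proj A s *m polar_unitary T *m spectral_proj A t).

Definition centered T : Prop :=
  let U := polar_unitary T in let A := absmx T in
  {in [set X | exists2 k, (0 < k)%N & X = (U ^t*) ^+ k *m A *m U ^+ k]
      `|` [set A]
      `|` [set X | exists2 k, (0 < k)%N & X = U ^+ k *m A *m (U ^t*) ^+ k] &,
    forall X Y, comm_mx X Y}.

Definition hadamard A B : 'M[R[i]]_m := \matrix_(i, j) (A i j * B i j).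

End InducedAluthge.

(* Representing function of the weighted power mean. *)
Definition power_mean_fun (R : realType) (r lambda x : R) : R :=
  (1 - lambda + lambda * x `^ r) `^ r^-1.

(* Main.v *)
Require Import Defs.
From HB Require Import structures.
From mathcomp Require Import all_boot all_order all_algebra.
From mathcomp Require Import sesquilinear spectral.
From mathcomp Require Import complex.
From mathcomp Require Import all_classical all_reals all_analysis.
From mathcomp Require Import ring.

(* For positive definite A and unitary U, the induced Aluthge transform of U A
   keeps the factor U as soon as A commutes with U^* A U, or r = 1, and it
   replaces B = A^r by the average (1 - lambda) U^* B U + lambda B. In the basis
   where U is diagonal, this average multiplies the entry (i, j) of B by
   (1 - lambda) conj(alpha_i) alpha_j + lambda, which is 1 for i = j and has
   modulus < 1 otherwise, so that the iterates of B converge to their common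
   diagonal part. When T is centered, all these iterates are diagonal in one
   fixed basis, so that the continuity of X |-> X^(1/r) reduces to that of the
   real power; when r = 1 no power has to be taken. *)

Set Implicit Arguments.
Unset Strict Implicit.
Unset Printing Implicit Defensive.

Import Order.TTheory GRing.Theory Num.Theory numFieldNormedType.Exports.

Local Open Scope classical_set_scope.
Local Open Scope ring_scope.
Local Open Scope sesquilinear_scope.

Lemma sum_pred1_seq (S : nmodType) (I : eqType) (s : seq I) (x : I)
    (g : I -> S) : uniq s -> x \in s -> \sum_(y <- s) g y *+ (x == y) = g x.
Proof.
move=> us xs; rewrite (bigD1_seq x) //= eqxx mulr1n big1 ?addr0 // => y yx.
by rewrite eq_sym (negPf yx).
Qed.

(** * Conjugate transposes, unitary conjugation and spectral projections *)

Section SpectralTheory.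
Variable C : numClosedFieldType.

Lemma trmxC_mul m n p (A : 'M[C]_(m, n)) (B : 'M[C]_(n, p)) :
  (A *m B)^t* = B^t* *m A^t*.
Proof. by rewrite trmx_mul map_mxM. Qed.

Lemma trmxCD m n (A B : 'M[C]_(m, n)) : (A + B)^t* = A^t* + B^t*.
Proof. by rewrite linearD /= map_mxD. Qed.

Lemma trmxCB m n (A B : 'M[C]_(m, n)) : (A - B)^t* = A^t* - B^t*.
Proof. by rewrite linearB /= map_mxB. Qed.

Lemma trmxCZ m n a (A : 'M[C]_(m, n)) : (a *: A)^t* = a^* *: A^t*.
Proof. by rewrite linearZ /= map_mxZ. Qed.

Lemma trmxC1 n : (1%:M : 'M[C]_n)^t* = 1%:M.
Proof. by rewrite trmx1 map_mx1. Qed.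

Variable n : nat.
Implicit Types (W X A B U : 'M[C]_n) (d e : 'rV[C]_n).

Lemma trmxC_diag d : (diag_mx d)^t* = diag_mx (map_mx Num.conj d).
Proof. by rewrite tr_diag_mx map_diag_mx. Qed.

Lemma mulmxVC W : W \is unitarymx -> W *m W^t* = 1%:M.
Proof. by move/unitarymxP. Qed.

Lemma mulVCmx W : W \is unitarymx -> W^t* *m W = 1%:M.
Proof. by move=> Wu; rewrite -invmx_unitary // mulVmx // unitarymx_unit. Qed.

Lemma conj_unitarymxK W X : W \is unitarymx ->
  W *m (W^t* *m X *m W) *m W^t* = X.
Proof.
move=> Wu; rewrite !mulmxA (mulmxVC Wu) mul1mx -mulmxA (mulmxVC Wu).
by rewrite mulmx1.
Qed.

Lemma conj_unitarymxKV W X : W \is unitarymx ->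
  W^t* *m (W *m X *m W^t*) *m W = X.
Proof.
move=> Wu; rewrite !mulmxA (mulVCmx Wu) mul1mx -mulmxA (mulVCmx Wu).
by rewrite mulmx1.
Qed.

Lemma conj_unitarymxM W X Y : W \is unitarymx ->
  (W^t* *m X *m W) *m (W^t* *m Y *m W) = W^t* *m (X *m Y) *m W.
Proof.
move=> Wu; rewrite !mulmxA -(mulmxA _ W) (mulmxVC Wu) mulmx1.
by rewrite -!mulmxA.
Qed.

Lemma conj_unitarymx_herm W X :
  (W^t* *m X *m W)^t* = W^t* *m X^t* *m W.
Proof. by rewrite !trmxC_mul trmxCK mulmxA. Qed.

(** Let Q be the right-hand side and P the projection. The rows of Q lie in the eigenspace, so that
    Q P = Q. Since Q is Hermitian and fixes the eigenspace, the rows of 1 - Q are orthogonal to it,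
    so that (1 - Q) P = 0. Hence P = Q. *)
Lemma proj_eigenspace_diag W d s : W \is unitarymx ->
  proj_ortho (eigenspace (W^t* *m diag_mx d *m W) s) =
  W^t* *m diag_mx (\row_j (d 0 j == s)%:R) *m W.
Proof.
move=> Wu; set A := W^t* *m diag_mx d *m W.
set D := diag_mx _; set Q := W^t* *m D *m W.
have QE : (Q <= eigenspace A s)%MS.
  apply/eigenspaceP; rewrite /Q /A conj_unitarymxM // mulmx_diag.
  rewrite scalemxAl scalemxAr; congr (_ *m _ *m _); apply/matrixP=> i j.
  rewrite !mxE mulrnAr; congr (_ *+ _).
  by case: eqVneq => [->|_]; rewrite ?mul0r ?mulr0 // mul1r mulr1.
have Qh : Q^t* = Q.
  rewrite conj_unitarymx_herm trmxC_diag; congr (_ *m diag_mx _ *m _).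
  by apply/rowP=> j; rewrite !mxE conjC_nat.
have EQ : eigenspace A s *m Q = eigenspace A s.
  have /eigenspaceP := submx_refl (eigenspace A s).
  set E := eigenspace A s => EA.
  (* For Y = E W^*, this equation forces Y i j = 0 unless d j = s, so that the 0-1 diagonal matrix
     fixes Y. *)
  have XE : E *m W^t* *m diag_mx d = s *: (E *m W^t*).
    by rewrite scalemxAl -EA /A !mulmxA -[RHS]mulmxA (mulmxVC Wu) mulmx1.
  have : E *m W^t* *m W = E by rewrite -mulmxA (mulVCmx Wu) mulmx1.
  rewrite /Q !mulmxA; move: (E *m W^t*) XE => Y YE YW.
  rewrite -[RHS]YW; congr (_ *m W).
  apply/matrixP=> i j; have /matrixP /(_ i j) := YE.
  rewrite /D !mul_mx_diag !mxE => eX.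
  case: eqVneq => [_|ds]; first by rewrite mulr1.
  rewrite mulr0; apply/eqP; rewrite eq_sym.
  have : Y i j * (d 0 j - s) == 0 by rewrite mulrBr eX mulrC subrr.
  by rewrite mulf_eq0 subr_eq0 (negPf ds) orbF.
have QP : Q *m proj_ortho (eigenspace A s) = Q by exact: proj_ortho_id.
have : (1%:M - Q) *m proj_ortho (eigenspace A s) = 0.
  apply: proj_ortho_0; rewrite orthomx1E -[1%:M - Q]trmxCK -trmxC_mul.
  by rewrite trmxCB trmxC1 Qh mulmxBr mulmx1 EQ subrr trmx0 map_mx0.
by rewrite mulmxBl mul1mx QP => /subr0_eq.
Qed.

Lemma normalmx_conj_diag W d : W \is unitarymx ->
  W^t* *m diag_mx d *m W \is normalmx.
Proof.
move=> Wu; apply/orthomx_spectral_subproof; exists (W, d) => //=.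
by rewrite invmx_unitary.
Qed.

(** [spectral_diag] belongs to a diagonalization that may differ from [W]. Were d j missing from it,
    the projection for d j computed from that diagonalization would vanish, whereas the one computed
    from [W] has a 1 at (j, j) in the basis [W]. *)
Lemma mem_spectral_diag W d j : W \is unitarymx ->
  d 0 j \in [seq spectral_diag (W^t* *m diag_mx d *m W) ord0 i | i : 'I_n].
Proof.
move=> Wu; have Anorm := normalmx_conj_diag d Wu.
have := proj_eigenspace_diag d (d 0 j) Wu.
set A := W^t* *m _ *m W in Anorm *.
apply: contra_eqT => dN.
have /orthomx_spectralP -> := Anorm.
have Su := spectral_unitarymx A.
rewrite invmx_unitary // proj_eigenspace_diag //.
have -> : \row_k (spectral_diag A 0 k == d 0 j)%:R = 0 :> 'rV[C]_n.
  apply/rowP=> k; rewrite !mxE; case: eqVneq => // skd.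
  by case/negP: dN; rewrite -skd; apply: map_f; rewrite mem_enum.
rewrite [diag_mx 0]raddf0 mulmx0 mul0mx eq_sym; apply/negP => /eqP.
move/(congr1 (fun X => W *m X *m W^t*)).
rewrite conj_unitarymxK // mulmx0 mul0mx => /matrixP /(_ j j).
by rewrite !mxE !eqxx => /eqP; rewrite oner_eq0.
Qed.

(** * Positive definite matrices and simultaneous diagonalization *)

Definition udiag W d : 'M[C]_n := W^t* *m diag_mx d *m W.

Definition posdefmx A :=
  A^t* = A /\ forall u : 'rV[C]_n, u != 0 -> 0 < (u *m A *m u^t*) 0 0.

Lemma quad_diag (u d : 'rV[C]_n) :
  (u *m diag_mx d *m u^t*) 0 0 = \sum_j d 0 j * `|u 0 j| ^+ 2.
Proof.
rewrite mul_mx_diag mxE; apply: eq_bigr => j _.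
by rewrite !mxE normCK mulrAC mulrC.
Qed.

Lemma posdefmxP A : posdefmx A <->
  exists W d, [/\ W \is unitarymx, forall j, 0 < d 0 j
                & A = udiag W d].
Proof.
split=> [[Ah Apos]|[W [d [Wu d0 ->]]]].
  have Aherm : A \is hermsymmx.
    by apply/is_hermitianmxP; rewrite expr0 scale1r.
  have /orthomx_spectralP := hermitian_normalmx Aherm.
  set W := spectralmx A; set s := spectral_diag A.
  have Wu : W \is unitarymx by exact: spectral_unitarymx.
  rewrite invmx_unitary // => Aeq.
  exists W, s; split=> // j.
  (* The j-th eigenvector, as a row: the quadratic form of [A] takes the j-th eigenvalue there. *)
  pose u := delta_mx 0 j *m W : 'rV_n.
  have uW : u *m W^t* = delta_mx 0 j by rewrite -mulmxA mulmxVC // mulmx1.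
  have u0 : u != 0.
    apply: contra_neq (oner_neq0 C) => u0; have := uW.
    by rewrite u0 mul0mx => /matrixP /(_ 0 j); rewrite !mxE !eqxx.
  have := Apos u u0.
  have -> : u *m A *m u^t* = (u *m W^t*) *m diag_mx s *m (u *m W^t*)^t*.
    by rewrite [in LHS]Aeq trmxC_mul trmxCK !mulmxA.
  rewrite uW quad_diag (bigD1 j) //= big1 ?addr0 => [|k kj].
    by rewrite mxE !eqxx normr1 expr1n mulr1.
  by rewrite mxE (negPf kj) andbF normr0 expr0n mulr0.
split=> [|u u0].
  rewrite conj_unitarymx_herm trmxC_diag; congr udiag.
  by apply/rowP=> j; rewrite mxE; apply/conj_Creal/gtr0_real.
have -> : u *m udiag W d *m u^t* =
          (u *m W^t*) *m diag_mx d *m (u *m W^t*)^t*.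
  by rewrite /udiag trmxC_mul trmxCK !mulmxA.
have v0 : u *m W^t* != 0.
  apply: contra_neq u0 => v0.
  by rewrite -[u]mulmx1 -(mulVCmx Wu) mulmxA v0 mul0mx.
have /rV0Pn [j vj] := v0.
rewrite quad_diag (bigD1 j) //= ltr_wpDr //.
  by apply: sumr_ge0 => k _; rewrite mulr_ge0 ?exprn_ge0 // ltW.
by rewrite mulr_gt0 // exprn_gt0 // normr_gt0.
Qed.

Lemma posdefmx_convex (a b : C) A B : 0 < a -> 0 < b ->
  posdefmx A -> posdefmx B -> posdefmx (a *: A + b *: B).
Proof.
move=> a0 b0 [Ah Ap] [Bh Bp]; split=> [|u u0].
  by rewrite trmxCD !trmxCZ Ah Bh !conj_Creal ?gtr0_real.
rewrite mulmxDr mulmxDl -!scalemxAr -!scalemxAl mxE [X in X + _]mxE.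
by rewrite [X in _ + X]mxE addr_gt0 // mulr_gt0 ?Ap ?Bp.
Qed.

Lemma posdefmx_conj U A : U \in unitmx -> posdefmx A ->
  posdefmx (U^t* *m A *m U).
Proof.
move=> Uu [Ah Ap]; split=> [|u u0]; first by rewrite conj_unitarymx_herm Ah.
have -> : u *m (U^t* *m A *m U) *m u^t* = (u *m U^t*) *m A *m (u *m U^t*)^t*.
  by rewrite trmxC_mul trmxCK !mulmxA.
apply: Ap; apply: contra_neq u0 => uU0.
have UCu : U^t* \in unitmx by rewrite map_unitmx unitmx_tr.
by rewrite -(mulmxK UCu u) uU0 mul0mx.
Qed.

Lemma posdefmx1 : posdefmx 1%:M.
Proof.
apply/posdefmxP; exists 1%:M, (const_mx 1); split=> [|j|].
- by apply/unitarymxP; rewrite mul1mx trmxC1.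
- by rewrite mxE ltr01.
- by rewrite /udiag diag_const_mx !mulmx1 trmxC1.
Qed.

Lemma posdefmx_gram A : A \in unitmx -> posdefmx (A^t* *m A).
Proof.
by move=> Au; rewrite -[A^t*]mulmx1; exact: posdefmx_conj Au posdefmx1.
Qed.

Lemma posdefmx_diag_gt0 A j : posdefmx A -> 0 < A j j.
Proof.
move=> [_ /(_ (delta_mx 0 j))].
have -> : (delta_mx 0 j : 'rV[C]_n)^t* = delta_mx j 0.
  by rewrite trmx_delta map_delta_mx.
rewrite -rowE -colE !mxE; apply; apply/rV0Pn; exists j.
by rewrite mxE !eqxx oner_neq0.
Qed.

Lemma posdefmx_unit A : posdefmx A -> A \in unitmx.
Proof.
move=> /posdefmxP [W [d [Wu d0 ->]]].
have dU : diag_mx d \in unitmx.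
  rewrite unitmxE det_diag unitfE; apply/prodf_neq0 => j _.
  by rewrite gt_eqF.
by rewrite !unitmx_mul dU !unitarymx_unit ?trmxC_unitary.
Qed.

(* The linear span of the sequence is already spanned by finitely many of its
   terms, and finite commuting families are simultaneously trigonalizable. *)
Lemma codiagonalization_herm (A : nat -> 'M[C]_n) :
  (forall k, (A k)^t* = A k) -> (forall k l, comm_mx (A k) (A l)) ->
  exists2 W, W \is unitarymx &
    forall k, exists d, A k = udiag W d.
Proof.
move=> Ah Ac.
pose S N := <<[seq A k | k <- iota 0 N]>>%VS.
have [N SN] : exists N, forall k, A k \in S N.
  have exr : exists r : nat, `[< exists N, \dim (S N) = r >].
    by exists (\dim (S 0)); apply/asboolP; exists 0.
  have ub (r : nat) : `[< exists N, \dim (S N) = r >] ->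
      (r <= \dim {:'M[C]_n})%N.
    by move=> /asboolP [N <-]; apply: dimvS; exact: subvf.
  (* [N] makes the dimension of the span maximal, so that adding the terms up to index [k] cannot
     enlarge it. *)
  case: (ex_maxnP exr ub) => r /asboolP [N rN] rmax; exists N => k.
  have SS : (S N <= S (N + k.+1)%N)%VS.
    apply: sub_span => X /mapP [l]; rewrite mem_iota add0n => /andP [_ lN] ->.
    by apply: map_f; rewrite mem_iota add0n leq0n ltn_addr.
  have -> : S N = S (N + k.+1)%N.
    apply/eqP; rewrite eqEdim SS rN; apply: rmax; apply/asboolP.
    by exists (N + k.+1)%N.
  apply: memv_span; apply: map_f.
  by rewrite mem_iota /= add0n addnS ltnS leq_addl.
have [|W Wu /allP Wtrig] := @cotrigonalization C n [seq A k | k <- iota 0 N].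
  by move=> _ _ /mapP [k _ ->] /mapP [l _ ->].
exists W => // k.
(* Diagonality in the basis [W] is a linear condition, hence it is enough to check it on generators;
   there, a triangular Hermitian matrix is diagonal. *)
suff Wd : forall X, X \in S N -> is_diag_mx (W *m X *m W^t*).
  have /diag_mxP [d dE] := Wd _ (SN k).
  by exists d; rewrite /udiag -dE conj_unitarymxKV.
move=> X /coord_span ->; rewrite mulmx_sumr mulmx_suml.
apply/is_diag_mxP => i j ij; rewrite summxE big1 // => l _.
rewrite -scalemxAr -scalemxAl mxE.
have lN : (l < size [seq A k | k <- iota 0 N])%N by rewrite size_map size_iota.
have /mapP [p pN ->] := mem_nth 0 lN.
have /= := Wtrig _ (map_f A pN); rewrite /similar_to /=.
rewrite conjumx ?unitarymx_unit // invmx_unitary //.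
have : (W *m A p *m W^t*)^t* = W *m A p *m W^t*.
  by rewrite !trmxC_mul trmxCK Ah mulmxA.
move: (W *m A p *m W^t*) => Y Yh /is_trig_mxP Ytrig.
move: ij; rewrite neq_ltn => /orP [ij|ji]; first by rewrite Ytrig // mulr0.
by rewrite -Yh !mxE Ytrig // rmorph0 mulr0.
Qed.


(** * Functional calculus and double spectral sums *)

Definition eigenvalues A : seq C :=
  undup [seq spectral_diag A ord0 i | i : 'I_n].

Definition eigenproj A s : 'M[C]_n := proj_ortho (eigenspace A s).

(** With [double_specsum], this mirrors over an abstract field the sums in [funmx] and [aluthge]. *)
Definition specfun (g : C -> C) A : 'M[C]_n :=
  \sum_(s <- eigenvalues A) g s *: eigenproj A s.

Definition double_specsum (c : C -> C -> C) A X : 'M[C]_n :=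
  \sum_(s <- eigenvalues A) \sum_(t <- eigenvalues A)
    c s t *: (eigenproj A s *m X *m eigenproj A t).

Lemma sum_eigenvalues (S : nmodType) W d j (g : C -> S) : W \is unitarymx ->
  \sum_(s <- eigenvalues (udiag W d)) g s *+ (d 0 j == s) = g (d 0 j).
Proof.
move=> Wu; apply: sum_pred1_seq; first exact: undup_uniq.
by rewrite mem_undup; exact: mem_spectral_diag.
Qed.

Lemma specfun_udiag g W d : W \is unitarymx ->
  specfun g (udiag W d) = udiag W (map_mx g d).
Proof.
move=> Wu; rewrite /specfun.
under eq_bigr => s _ do
  rewrite /eigenproj proj_eigenspace_diag // scalemxAl scalemxAr.
rewrite -mulmx_suml -mulmx_sumr; congr (_ *m _ *m _).
apply/matrixP=> i j; rewrite summxE !mxE.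
rewrite -(sum_eigenvalues d i (fun s => g s *+ (i == j)) Wu).
apply: eq_bigr => s _; rewrite !mxE mulrnAr mulr_natr.
by rewrite -!mulrnA mulnC.
Qed.

(** In an eigenbasis of the matrix, the double sum is a Schur multiplier: the projections cut [X]
    into blocks, and the entry (i, j) lies in the block of the eigenvalues d i and d j. *)
Lemma double_specsum_udiag c X W d : W \is unitarymx ->
  double_specsum c (udiag W d) X =
  W^t* *m (\matrix_(i, j) (c (d 0 i) (d 0 j) * (W *m X *m W^t*) i j)) *m W.
Proof.
move=> Wu; pose D s : 'M[C]_n := diag_mx (\row_j (d 0 j == s)%:R).
set Y := W *m X *m W^t*; set S := eigenvalues (udiag W d).
have -> : double_specsum c (udiag W d) X =
  W^t* *m (\sum_(s <- S) \sum_(t <- S) c s t *: (D s *m Y *m D t)) *m W.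
  rewrite mulmx_sumr mulmx_suml; apply: eq_bigr => s _.
  rewrite mulmx_sumr mulmx_suml; apply: eq_bigr => t _.
  rewrite /eigenproj !proj_eigenspace_diag // -/(D s) -/(D t).
  by rewrite -scalemxAr -scalemxAl /Y !mulmxA.
move: Y => Y; congr (_ *m _ *m _); apply/matrixP=> i j; rewrite summxE !mxE.
rewrite -(sum_eigenvalues d i (fun s => c s (d 0 j) * Y i j) Wu).
apply: eq_bigr => s _; rewrite summxE.
rewrite -(sum_eigenvalues d j (fun t => c s t * Y i j) Wu) -sumrMnl.
apply: eq_bigr => t _; rewrite mxE mul_mx_diag mxE mul_diag_mx !mxE.
by rewrite mulr_natr mulr_natl mulrnAr mulrnAr -!mulrnA mulnC.
Qed.

(** Serves the case [r = 1]. The condition on [c] is restricted to eigenvalues because the power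
    mean is linear at positive arguments. *)
Lemma double_specsum_linear a b c X W d : W \is unitarymx ->
  (forall i j, c (d 0 i) (d 0 j) = a * d 0 i + b * d 0 j) ->
  double_specsum c (udiag W d) X =
  a *: (udiag W d *m X) + b *: (X *m udiag W d).
Proof.
move=> Wu cE; rewrite double_specsum_udiag //.
have -> : a *: (udiag W d *m X) + b *: (X *m udiag W d) =
  W^t* *m (a *: (diag_mx d *m (W *m X *m W^t*)) +
           b *: ((W *m X *m W^t*) *m diag_mx d)) *m W.
  rewrite mulmxDr mulmxDl -!scalemxAr -!scalemxAl; congr (_ *: _ + _ *: _).
    by rewrite -!mulmxA (mulVCmx Wu) mulmx1 !mulmxA.
  by rewrite !mulmxA (mulVCmx Wu) mul1mx.
congr (_ *m _ *m _); apply/matrixP=> i j.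
rewrite mul_diag_mx mul_mx_diag; move: (W *m X *m W^t*) => Y.
by rewrite !mxE cE mulrDl -!mulrA [Y i j * _]mulrC.
Qed.

(** Y = W U W^* satisfies d i * Y i j = Y i j * e j. Wherever Y i j is nonzero, d i = e j, so that
    the multiplier c (d i) (d j) may be replaced by c (e j) (d j). This depends on j only and is
    thus a diagonal factor on the right. *)
Lemma double_specsum_comm c U W d e : U \is unitarymx -> W \is unitarymx ->
  U^t* *m udiag W d *m U = udiag W e ->
  double_specsum c (udiag W d) U = U *m udiag W (\row_j c (e 0 j) (d 0 j)).
Proof.
move=> Uu Wu UE; rewrite double_specsum_udiag //.
set Y := W *m U *m W^t*.
have YE : diag_mx d *m Y = Y *m diag_mx e.
  have : udiag W d *m U = U *m udiag W e.
    by rewrite -UE !mulmxA (mulmxVC Uu) mul1mx.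
  move=> /(congr1 (fun Z => W *m Z *m W^t*)).
  by rewrite /udiag !mulmxA (mulmxVC Wu) mul1mx -[_ *m W *m W^t*]mulmxA
             (mulmxVC Wu) mulmx1.
have -> : U *m udiag W (\row_j c (e 0 j) (d 0 j)) =
          W^t* *m (Y *m diag_mx (\row_j c (e 0 j) (d 0 j))) *m W.
  by rewrite /Y /udiag !mulmxA (mulVCmx Wu) mul1mx.
move: Y YE => Y YE; congr (_ *m _ *m _); apply/matrixP=> i j.
have /matrixP /(_ i j) := YE.
rewrite mul_diag_mx !mul_mx_diag !mxE => YEij.
have [Y0|Y0] := eqVneq (Y i j) 0; first by rewrite Y0 mulr0 mul0r.
have -> : d 0 i = e 0 j by apply: (mulIf Y0); rewrite YEij mulrC.
by rewrite mulrC.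
Qed.

Lemma udiag_conj U W d : U^t* *m udiag W d *m U = udiag (W *m U) d.
Proof. by rewrite /udiag trmxC_mul !mulmxA. Qed.

Lemma udiagD W d e a b :
  a *: udiag W d + b *: udiag W e = udiag W (a *: d + b *: e).
Proof.
rewrite /udiag scalemxAl scalemxAr [b *: _]scalemxAl scalemxAr.
by rewrite -mulmxDl -mulmxDr -!linearZ -linearD.
Qed.

Lemma udiagM W d e : W \is unitarymx ->
  udiag W d *m udiag W e = udiag W (\row_j (d 0 j * e 0 j)).
Proof. by move=> Wu; rewrite /udiag conj_unitarymxM // mulmx_diag. Qed.

(** Unlike [posdefmxP], this concerns a prescribed diagonalization; its eigenvalues are the diagonal
    entries once the conjugation is undone. *)
Lemma udiag_posdef W d : W \is unitarymx ->
  posdefmx (udiag W d) <-> forall j, 0 < d 0 j.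
Proof.
move=> Wu; split=> [pd j|d0]; last by apply/posdefmxP; exists W, d.
have := posdefmx_conj (U := W^t*) _ pd; rewrite trmxCK conj_unitarymxK //.
rewrite unitarymx_unit ?trmxC_unitary // => /(_ isT) pdW.
by have := posdefmx_diag_gt0 j pdW; rewrite !mxE eqxx mulr1n.
Qed.

End SpectralTheory.

(* [R[i]] is only accessed through this interface: with a concrete field,
   unification spends its time comparing the many structures of [R[i]]. *)
Record complexification (R : realType) (C : numClosedFieldType) := {
  ofR : {rmorphism R -> C};
  re : C -> R;
  ofRK : cancel ofR re;
  reK : forall z, 0 < z -> ofR (re z) = z;
  ltr_ofR : forall x y, (ofR x < ofR y) = (x < y);
  norm_ofR : forall x, `|ofR x| = ofR `|x|;
  reB : forall z w, re (z - w) = re z - re w;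
  ler_norm_re : forall z, ofR `|re z| <= `|z|
}.
Arguments ofRK {R C} _ x.
Arguments reK {R C} _ [z].

(** * Real powers of positive numbers in the abstract field *)

Section ComplexPowers.
Variables (R : realType) (C : numClosedFieldType) (S : complexification R C).
Local Notation ofR := (ofR S).
Local Notation re := (re S).
Implicit Types (x y p q : R) (z w : C).

Lemma ofR_gt0 x : (0 < ofR x) = (0 < x).
Proof. by rewrite -(rmorph0 ofR) ltr_ofR. Qed.

Lemma re_gt0 z : 0 < z -> 0 < re z.
Proof. by move=> z0; rewrite -ofR_gt0 reK. Qed.

Definition rpow p z : C := ofR (re z `^ p).

Lemma rpow_gt0 p z : 0 < z -> 0 < rpow p z.
Proof. by move=> /re_gt0 z0; rewrite ofR_gt0 powR_gt0. Qed.

Lemma rpowM p q z : rpow q (rpow p z) = rpow (p * q) z.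
Proof. by rewrite /rpow ofRK powRrM. Qed.

Lemma rpow1 z : 0 < z -> rpow 1 z = z.
Proof. by move=> z0; rewrite /rpow powRr1 ?reK // ltW // re_gt0. Qed.

Lemma rpow_sqr z : 0 < z -> rpow 2^-1 (z * z) = z.
Proof.
move=> z0; rewrite /rpow -{1 2}(reK S z0) -rmorphM ofRK -expr2.
by rewrite powR12_sqrt ?sqr_ge0 // sqrtr_sqr gtr0_norm ?re_gt0 // reK.
Qed.

(** Homogeneity of the power mean: s^r factors out of the weighted sum, and its power 1/r is s. *)
Lemma power_meanE (lambda r : R) (s t : C) :
  0 < lambda < 1 -> r != 0 -> 0 < s -> 0 < t ->
  ofR (re s * power_mean_fun r lambda (re t / re s)) =
  rpow r^-1 (ofR (1 - lambda) * rpow r s + ofR lambda * rpow r t).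
Proof.
move=> /andP [l0 l1] r0 /re_gt0 s0 /re_gt0 t0.
rewrite /rpow -!rmorphM -rmorphD ofRK; congr (ofR _).
move: (re s) (re t) s0 t0 => {}s {}t s0 t0; rewrite /power_mean_fun.
have m0 : 0 <= 1 - lambda + lambda * (t / s) `^ r.
  by rewrite addr_ge0 ?subr_ge0 1?ltW // mulr_gt0 ?powR_gt0 ?divr_gt0.
have -> : (1 - lambda) * s `^ r + lambda * t `^ r =
          s `^ r * (1 - lambda + lambda * (t / s) `^ r).
  rewrite mulrDr [s `^ r * (1 - _)]mulrC mulrCA -powRM ?ltW ?divr_gt0 //.
  by rewrite [s * _]mulrC divfK // gt_eqF.
by rewrite [RHS]powRM ?powR_ge0 // -powRrM divff // powRr1 // ltW.
Qed.

End ComplexPowers.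

(** * Powers of positive definite matrices and the transform of a polar decomposition *)

Section PositivePowers.
Variables (R : realType) (C : numClosedFieldType) (S : complexification R C).
Variable n : nat.
Local Notation ofR := (ofR S).
Local Notation re := (re S).
Local Notation rpow := (rpow S).
Implicit Types (W X A B U T : 'M[C]_n) (d e : 'rV[C]_n).

Definition mpow A p : 'M[C]_n := specfun (rpow p) A.

Lemma mpow_udiag W d p : W \is unitarymx ->
  mpow (udiag W d) p = udiag W (map_mx (rpow p) d).
Proof. exact: specfun_udiag. Qed.

Lemma mpow_posdef A p : posdefmx A -> posdefmx (mpow A p).
Proof.
move=> /posdefmxP [W [d [Wu d0 ->]]]; rewrite mpow_udiag //.
by apply/udiag_posdef => // j; rewrite mxE rpow_gt0.
Qed.

Lemma mpow_conj U A p : U \is unitarymx -> posdefmx A ->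
  mpow (U^t* *m A *m U) p = U^t* *m mpow A p *m U.
Proof.
move=> Uu /posdefmxP [W [d [Wu d0 ->]]]; rewrite mpow_udiag //.
by rewrite !udiag_conj (mpow_udiag _ _ (mul_unitarymx Wu Uu)).
Qed.

Lemma mpowM A p q : posdefmx A -> mpow (mpow A p) q = mpow A (p * q).
Proof.
move=> /posdefmxP [W [d [Wu d0 ->]]]; rewrite !(mpow_udiag _ _ Wu).
by congr udiag; apply/rowP=> j; rewrite !mxE rpowM.
Qed.

Lemma mpow1 A : posdefmx A -> mpow A 1 = A.
Proof.
move=> /posdefmxP [W [d [Wu d0 ->]]]; rewrite mpow_udiag //.
by congr udiag; apply/rowP=> j; rewrite !mxE rpow1.
Qed.

Lemma mpow_sqr A : posdefmx A -> mpow (A *m A) 2^-1 = A.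
Proof.
move=> /posdefmxP [W [d [Wu d0 ->]]]; rewrite udiagM // mpow_udiag //.
by congr udiag; apply/rowP=> j; rewrite !mxE rpow_sqr.
Qed.

Definition modulus T : 'M[C]_n := mpow (T^t* *m T) 2^-1.

Definition aluthge_cplx f T : 'M[C]_n :=
  double_specsum (fun s t => ofR (re s * f (re t / re s)))
    (modulus T) (T *m invmx (modulus T)).

Lemma modulus_posdef T : T \in unitmx -> posdefmx (modulus T).
Proof. by move=> Tu; apply/mpow_posdef/posdefmx_gram. Qed.

(** Uniqueness of the polar decomposition, from (U A)^* (U A) = A^2. It lets the transform be
    iterated on products [U *m A]. *)
Lemma modulus_polar U A : U \is unitarymx -> posdefmx A -> modulus (U *m A) = A.
Proof.
move=> Uu pA; rewrite /modulus trmxC_mul mulmxA -(mulmxA _ _ U) mulVCmx //.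
by rewrite mulmx1 pA.1 mpow_sqr.
Qed.

Lemma aluthge_polar f U A : U \is unitarymx -> posdefmx A ->
  aluthge_cplx f (U *m A) =
  double_specsum (fun s t => ofR (re s * f (re t / re s))) A U.
Proof.
move=> Uu pA; rewrite /aluthge_cplx modulus_polar // mulmxK //.
exact: posdefmx_unit.
Qed.

(** * Iterates of the transform with a fixed unitary factor *)

Variables (lambda r : R) (U : 'M[C]_n).
Hypotheses (lambda01 : 0 < lambda < 1) (r0 : r != 0) (Uu : U \is unitarymx).

Definition conj_avg X : 'M[C]_n :=
  ofR (1 - lambda) *: (U^t* *m X *m U) + ofR lambda *: X.

Local Notation Delta := (aluthge_cplx (power_mean_fun r lambda)).

Lemma conj_avg_posdef X : posdefmx X -> posdefmx (conj_avg X).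
Proof.
have /andP [l0 l1] := lambda01 => pX.
have pUX := posdefmx_conj (unitarymx_unit Uu) pX.
by apply: posdefmx_convex pUX pX; rewrite ofR_gt0 ?subr_gt0.
Qed.

(** The coefficient is (1 - lambda) s + lambda t, and A U = U (U^* A U) brings the factor [U] to the
    left of both terms. *)
Lemma aluthge_step1 A : r = 1 -> posdefmx A -> Delta (U *m A) = U *m conj_avg A.
Proof.
move=> r1 pA; rewrite aluthge_polar //.
have /posdefmxP [W [d [Wu d0 AE]]] := pA; rewrite AE.
rewrite (@double_specsum_linear _ _ (ofR (1 - lambda)) (ofR lambda)) //.
  rewrite /conj_avg mulmxDr -!scalemxAr; congr (_ *: _ + _).
  by rewrite !mulmxA mulmxVC // mul1mx.
by move=> i j; rewrite power_meanE // r1 invr1 !rpow1 // addr_gt0 ?mulr_gt0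
  ?ofR_gt0 ?subr_gt0 //; case/andP: lambda01.
Qed.

(** Both B and U^* B U are diagonal in the basis [W], so that [double_specsum_comm] applies to their
    powers 1/r; the power mean then turns these into the power 1/r of (1 - lambda) e + lambda b. *)
Lemma aluthge_step_comm W (b e : 'rV[C]_n) :
  W \is unitarymx -> (forall j, 0 < b 0 j) ->
  (forall j, 0 < e 0 j) -> U^t* *m udiag W b *m U = udiag W e ->
  Delta (U *m mpow (udiag W b) r^-1) =
  U *m mpow (conj_avg (udiag W b)) r^-1.
Proof.
move=> Wu b0 e0 UE.
have pb : posdefmx (udiag W b) by apply/udiag_posdef.
rewrite (aluthge_polar _ Uu (mpow_posdef _ pb)) (mpow_udiag _ _ Wu).
rewrite (@double_specsum_comm _ _ _ _ _ _ (map_mx (rpow r^-1) e)) //.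
  rewrite /conj_avg UE udiagD (mpow_udiag _ _ Wu); congr (U *m udiag W _).
  apply/rowP=> j; rewrite !mxE power_meanE ?rpow_gt0 //.
  by rewrite !rpowM mulVf // !rpow1.
by rewrite -(mpow_udiag b _ Wu) -(mpow_udiag e _ Wu) -mpow_conj // UE.
Qed.

Lemma iter_aluthge1 A k : r = 1 -> posdefmx A ->
  iter k Delta (U *m A) = U *m iter k conj_avg A.
Proof.
move=> r1 pA; elim: k => //= k ->; apply: aluthge_step1 => //.
by elim: k => //= k; exact: conj_avg_posdef.
Qed.

(* That T is centered amounts to [codiag W (|T|^r)] for some unitary [W]. *)
Definition codiag W X :=
  forall k, exists2 d : 'rV[C]_n, (forall j, 0 < d 0 j) &
    iter k (fun Y => U^t* *m Y *m U) X = udiag W d.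

Lemma iter_conjD k (a b : C) X Y :
  iter k (fun Y => U^t* *m Y *m U) (a *: X + b *: Y) =
  a *: iter k (fun Y => U^t* *m Y *m U) X +
  b *: iter k (fun Y => U^t* *m Y *m U) Y.
Proof.
elim: k => //= k ->.
by rewrite mulmxDr mulmxDl -!scalemxAr -!scalemxAl.
Qed.

(** The k-th conjugate of the average is the average of the conjugates k + 1 and k of [X]; hence the
    quantification over all [k] in [codiag]. *)
Lemma codiag_conj_avg W X : codiag W X -> codiag W (conj_avg X).
Proof.
move=> cX k; rewrite /conj_avg iter_conjD.
have [d d0 ->] := cX k; have [e e0] := cX k.+1; rewrite iterSr => ->.
rewrite udiagD.
eexists; last by [].
move=> j; rewrite !mxE.
have /andP [l0 l1] := lambda01.
by rewrite addr_gt0 ?mulr_gt0 ?ofR_gt0 ?subr_gt0.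
Qed.

Lemma iter_codiag W X k : codiag W X -> codiag W (iter k conj_avg X).
Proof. by move=> cX; elim: k => //= k; exact: codiag_conj_avg. Qed.

Lemma iter_aluthge_codiag W B k : W \is unitarymx -> codiag W B ->
  iter k Delta (U *m mpow B r^-1) = U *m mpow (iter k conj_avg B) r^-1.
Proof.
move=> Wu cB; elim: k => //= k ->.
have cBk := iter_codiag k cB.
(* The indices 0 and 1 give the current iterate and its conjugate by [U]. *)
have [b b0 /= bE] := cBk 0%N; have [e e0 /= eE] := cBk 1%N.
by rewrite bE; apply: (aluthge_step_comm (e := e)) => //; rewrite -bE.
Qed.

(** Real powers commute with unitary conjugation and keep an eigenbasis. *)
Lemma codiag_mpow W A : W \is unitarymx -> posdefmx A ->
  (forall k, exists d, iter k (fun Y => U^t* *m Y *m U) A = udiag W d) ->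
  codiag W (mpow A r).
Proof.
move=> Wu pA WA k.
have pAk l : posdefmx (iter l (fun Y => U^t* *m Y *m U) A).
  elim: l => //= l pAl; exact: posdefmx_conj (unitarymx_unit Uu) pAl.
have -> : iter k (fun Y => U^t* *m Y *m U) (mpow A r) =
          mpow (iter k (fun Y => U^t* *m Y *m U) A) r.
  by elim: k => //= k ->; rewrite mpow_conj.
have := pAk k; have [d ->] := WA k; rewrite mpow_udiag // => /udiag_posdef d0.
by exists (map_mx (rpow r) d) => // j; rewrite mxE rpow_gt0 // d0.
Qed.

End PositivePowers.

(** * Entrywise convergence of matrices *)

Section MatrixLimits.
Variables (K : numFieldType) (I : Type) (F : set_system I).
Hypothesis FF : Filter F.

(** A neighbourhood of a matrix contains a product of neighbourhoods of its entries, and filters are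
    stable under finite intersections. *)
Lemma cvg_mx_entries m n (M : I -> 'M[K]_(m, n)) (L : 'M[K]_(m, n)) :
  (forall i j, M x i j @[x --> F] --> L i j) <-> M x @[x --> F] --> L.
Proof.
split=> [ML A [P LP PA]|ML i j].
  apply: (@filterS _ F _ (fun x => forall i j, P i j (M x i j))).
    by move=> x Px; apply: PA.
  apply: (filter_forall (f := fun i x => forall j, P i j (M x i j))) => i.
  by apply: (filter_forall (f := fun j x => P i j (M x i j))) => j; apply/ML/LP.
exact: (cvg_comp M (fun N : 'M[K]_(m, n) => N i j) ML
  (@coord_continuous K m n i j L)).
Qed.

Lemma cvg_mulmx m n p (M : I -> 'M[K]_(m, n)) (N : I -> 'M[K]_(n, p))
    (L : 'M[K]_(m, n)) (L' : 'M[K]_(n, p)) :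
  M x @[x --> F] --> L -> N x @[x --> F] --> L' ->
  (M x *m N x) @[x --> F] --> L *m L'.
Proof.
move=> /cvg_mx_entries ML /cvg_mx_entries NL; apply/cvg_mx_entries => i j.
under eq_fun do rewrite mxE.
rewrite mxE; apply: (cvg_big (@add_continuous K)) => k _.
exact: cvgM (ML i k) (NL k j).
Qed.

Lemma cvg_diag_mx n (d : I -> 'rV[K]_n) (e : 'rV[K]_n) :
  d x @[x --> F] --> e -> diag_mx (d x) @[x --> F] --> diag_mx e.
Proof.
move=> /cvg_mx_entries de; apply/cvg_mx_entries => i j.
under eq_fun do rewrite mxE.
rewrite mxE; case: eqVneq => _; last exact: cvg_cst.
by under eq_fun do rewrite mulr1n; exact: de.
Qed.

End MatrixLimits.

(** * Limits of powers in the abstract field *)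

Section ComplexLimits.
Variables (R : realType) (C : numClosedFieldType) (S : complexification R C).
Local Notation ofR := (ofR S).
Local Notation re := (re S).
Local Notation rpow := (rpow S).

Lemma cvg_ofR (u : nat -> R) (l : R) :
  u k @[k --> \oo] --> l -> ofR (u k) @[k --> \oo] --> ofR l.
Proof.
move=> /cvgrPdist_lt ul; apply/cvgrPdist_lt => e e0.
near=> k; rewrite -rmorphB norm_ofR -(reK S e0) ltr_ofR.
by near: k; apply: ul; rewrite re_gt0.
Unshelve. all: by end_near. Qed.

Lemma cvg_re (u : nat -> C) (l : C) :
  u k @[k --> \oo] --> l -> re (u k) @[k --> \oo] --> re l.
Proof.
move=> /cvgrPdist_lt ul; apply/cvgrPdist_lt => e e0.
near=> k; rewrite -reB -(ltr_ofR S); apply: le_lt_trans (ler_norm_re _ _) _.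
by near: k; apply: ul; rewrite ofR_gt0.
Unshelve. all: by end_near. Qed.

Lemma cvg_powR (u : nat -> R) (l p : R) : 0 < l ->
  u k @[k --> \oo] --> l -> (u k) `^ p @[k --> \oo] --> l `^ p.
Proof.
move=> l0 ul.
have D : derivable (@powR R ^~ p) l 1.
  by apply: derivable_powR; rewrite in_itv /= l0.
move/derivable1_diffP/differentiable_continuous: D => D.
exact: (cvg_comp u (@powR R ^~ p) ul D).
Qed.

Lemma cvg_rpow (u : nat -> C) (l : C) (p : R) : 0 < l ->
  u k @[k --> \oo] --> l -> rpow p (u k) @[k --> \oo] --> rpow p l.
Proof.
by move=> l0 ul; apply/cvg_ofR/cvg_powR/cvg_re => //; rewrite re_gt0.
Qed.

Lemma ofR_re_norm (q : C) : ofR (re `|q|) = `|q|.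
Proof.
(* [reK] covers positive numbers only; at 0, the value of [re] comes from [ofRK]. *)
have [->|q0] := eqVneq q 0; last by rewrite reK // normr_gt0.
by rewrite normr0 -{1}(rmorph0 ofR) ofRK rmorph0.
Qed.

Lemma cvg_exp0 (q : C) : `|q| < 1 -> q ^+ k @[k --> \oo] --> 0.
Proof.
move=> q1; set rho := re `|q|.
have rho0 : 0 <= rho.
  by rewrite leNgt -(ltr_ofR S) ofR_re_norm rmorph0 normr_lt0.
have : `|rho| < 1 by rewrite ger0_norm // -(ltr_ofR S) ofR_re_norm rmorph1.
move=> /cvg_expr /cvgrPdist_lt rho_cvg; apply/cvgrPdist_lt => e e0.
near=> k; rewrite sub0r normrN normrX -ofR_re_norm -rmorphXn.
rewrite -(reK S e0) ltr_ofR.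
(* Restores the form |0 - rho^k| in which [rho_cvg] bounds the real geometric sequence. *)
rewrite -[_ ^+ _]ger0_norm ?exprn_ge0 // -normrN -[- _]sub0r.
by near: k; apply: rho_cvg; rewrite re_gt0.
Unshelve. all: by end_near. Qed.

(** Strict convexity of the disc, in the form 1 - |a z + b|^2 = a b |z - 1|^2. *)
Lemma norm_convex_lt1 (a b z : C) : 0 < a -> 0 < b -> a + b = 1 ->
  `|z| = 1 -> z != 1 -> `|a * z + b| < 1.
Proof.
move=> a0 b0 ab1 z1 zN1.
have zz : z * z^* = 1 by rewrite -normCK z1 expr1n.
have ac : a^* = a by apply/conj_Creal/gtr0_real.
have bc : b^* = b by apply/conj_Creal/gtr0_real.
rewrite -(@expr_lt1 _ 2) // normCK -subr_gt0.
have -> : 1 - (a * z + b) * (a * z + b)^* = a * b * `|z - 1| ^+ 2.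
  rewrite normCK rmorphD rmorphB rmorphM rmorph1 /= ac bc.
  have -> : b = 1 - a by rewrite -ab1 addrAC subrr add0r.
  by rewrite !(mulrDl, mulrDr, mulrBl, mulrBr) zz; ring: zz.
by rewrite pmulr_rgt0 ?exprn_gt0 ?normr_gt0 ?subr_eq0 ?mulr_gt0.
Qed.

(** * Convergence of the averages and of their powers *)

Variable n : nat.
Variables (lambda r : R) (U V : 'M[C]_n) (alpha : 'rV[C]_n).
Hypotheses (lambda01 : 0 < lambda < 1) (r0 : r != 0).
Hypotheses (Uu : U \is unitarymx) (Vu : V \is unitarymx).
Hypotheses (UE : U = udiag V alpha).
Hypothesis alpha_neq : forall i j, i != j -> alpha 0 i != alpha 0 j.
Implicit Types (X B W : 'M[C]_n).

Local Notation conj_avg := (conj_avg S lambda U).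

Lemma alpha_norm i : `|alpha 0 i| = 1.
Proof.
have := mulmxVC Uu; rewrite UE /udiag conj_unitarymx_herm trmxC_diag.
rewrite conj_unitarymxM // => /(congr1 (fun Z => V *m Z *m V^t*)).
rewrite conj_unitarymxK // mulmx1 mulmxVC // mulmx_diag.
move=> /matrixP /(_ i i); rewrite !mxE eqxx mulr1n -normCK => /eqP.
by rewrite sqrp_eq1 // => /eqP.
Qed.

Definition phase i j : C :=
  ofR (1 - lambda) * ((alpha 0 i)^* * alpha 0 j) + ofR lambda.

Lemma phase_diag i : phase i i = 1.
Proof.
rewrite /phase mulrC [_^* * _]mulrC -normCK alpha_norm expr1n mul1r -rmorphD.
by rewrite subrK rmorph1.
Qed.

Lemma phase_lt1 i j : i != j -> `|phase i j| < 1.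
Proof.
have /andP [l0 l1] := lambda01 => ij.
apply: norm_convex_lt1; rewrite ?ofR_gt0 ?subr_gt0 //.
- by rewrite -rmorphD subrK rmorph1.
- by rewrite normrM norm_conjC !alpha_norm mulr1.
(* If conj(alpha i) times alpha j were 1, multiplying by alpha i, of modulus 1, would give alpha j =
   alpha i. *)
apply: contra_neq (alpha_neq ij) => /(congr1 (fun z => alpha 0 i * z)).
by rewrite mulrA -normCK alpha_norm expr1n mul1r mulr1.
Qed.

Lemma conj_avg_entries X i j :
  (V *m conj_avg X *m V^t*) i j = phase i j * (V *m X *m V^t*) i j.
Proof.
have -> : V *m conj_avg X *m V^t* =
    ofR (1 - lambda) *: (diag_mx (map_mx Num.conj alpha) *m
                         (V *m X *m V^t*) *m diag_mx alpha) +
    ofR lambda *: (V *m X *m V^t*).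
  rewrite /conj_avg mulmxDr mulmxDl -!scalemxAr -!scalemxAl.
  congr (_ *: _ + _); rewrite UE /udiag conj_unitarymx_herm trmxC_diag.
  rewrite !mulmxA (mulmxVC Vu) mul1mx -!mulmxA (mulmxVC Vu) mulmx1.
  by rewrite !mulmxA.
move: (V *m X *m V^t*) => Y.
rewrite mul_mx_diag mul_diag_mx !mxE /phase.
by ring.
Qed.

Lemma iter_conj_avg_entries X k i j :
  (V *m iter k conj_avg X *m V^t*) i j =
  phase i j ^+ k * (V *m X *m V^t*) i j.
Proof.
elim: k => [|k IH] /=; first by rewrite mul1r.
by rewrite conj_avg_entries IH exprS mulrA.
Qed.

(** The pinching of [X] to the eigenbasis of [U]; [hadamard1mx] identifies it with the Hadamard
    product by the identity. *)
Definition conj_avg_limit X := udiag V (\row_i (V *m X *m V^t*) i i).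

Lemma cvg_conj_avg X : iter k conj_avg X @[k --> \oo] --> conj_avg_limit X.
Proof.
suff XL : (V *m iter k conj_avg X *m V^t*) @[k --> \oo] -->
          diag_mx (\row_i (V *m X *m V^t*) i i).
  have -> : (fun k => iter k conj_avg X) =
            (fun k => V^t* *m (V *m iter k conj_avg X *m V^t*) *m V).
    by apply/funext => k; rewrite conj_unitarymxKV.
  by apply: cvg_mulmx; [apply: cvg_mulmx => // |]; exact: cvg_cst.
apply/cvg_mx_entries => i j; under eq_fun do rewrite iter_conj_avg_entries.
move: (V *m X *m V^t*) => Y; rewrite !mxE; have [<-|ij] := eqVneq i j.
  rewrite mulr1n; under eq_fun do rewrite phase_diag expr1n mul1r.
  exact: cvg_cst.
rewrite mulr0n -(mul0r (Y i j)).
apply: cvgM; last exact: cvg_cst.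
by apply: cvg_exp0; exact: phase_lt1.
Qed.

(** Positivity of the limit makes real powers, of either sign, continuous there. *)
Lemma conj_avg_limit_posdef X : posdefmx X -> posdefmx (conj_avg_limit X).
Proof.
move=> pX; apply/(udiag_posdef _ Vu) => j; rewrite mxE.
apply: posdefmx_diag_gt0; rewrite -{1}[V]trmxCK; apply: posdefmx_conj => //.
by rewrite unitarymx_unit // trmxC_unitary.
Qed.

(** The limit is diagonal in the basis [V] by construction. As a limit of matrices diagonal in the
    basis [W], it is also diagonal in [W], where the power acts on each diagonal entry
    separately. *)
Lemma cvg_mpow_codiag W B p : W \is unitarymx -> posdefmx B ->
  codiag U W B ->
  mpow S (iter k conj_avg B) p @[k --> \oo] --> mpow S (conj_avg_limit B) p.
Proof.
move=> Wu pB cB; pose c k := W *m iter k conj_avg B *m W^t*.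
have BE k : exists d, iter k conj_avg B = udiag W d.
  by have [d _ dE] := iter_codiag S lambda01 k cB 0%N; exists d.
have cE k : c k = diag_mx (\row_i c k i i).
  rewrite /c; have [d ->] := BE k; rewrite conj_unitarymxK //.
  by congr diag_mx; apply/rowP=> i; rewrite !mxE eqxx mulr1n.
pose cl := W *m conj_avg_limit B *m W^t*.
have ccl : c k @[k --> \oo] --> cl.
  apply: cvg_mulmx; last exact: cvg_cst.
  by apply: cvg_mulmx; [exact: cvg_cst | exact: cvg_conj_avg].
have rcl : (\row_i c k i i) @[k --> \oo] --> (\row_i cl i i : 'rV[C]_n).
  apply/cvg_mx_entries => i j; under eq_fun do rewrite mxE.
  by rewrite mxE; move/cvg_mx_entries: ccl; apply.
have cl0 i j : i != j -> cl i j = 0.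
  move=> ij; move/cvg_mx_entries: ccl => /(_ i j) cij.
  have c0 : c k i j @[k --> \oo] --> 0.
    under eq_fun do rewrite cE mxE (negPf ij) mulr0n.
    exact: cvg_cst.
  exact: (cvg_unique _ cij c0).
have clE : cl = diag_mx (\row_i cl i i).
  move: cl0; move: (cl) => M M0; apply/matrixP=> i j; rewrite !mxE.
  by case: eqVneq => [->|/M0]; rewrite ?mulr1n ?mulr0n.
have LE : conj_avg_limit B = udiag W (\row_i cl i i).
  by rewrite /udiag -clE conj_unitarymxKV.
have lpos : forall i, 0 < (\row_i cl i i) 0 i.
  by apply/(udiag_posdef _ Wu); rewrite -LE; exact: conj_avg_limit_posdef.
rewrite LE mpow_udiag //.
have -> : (fun k => mpow S (iter k conj_avg B) p) =
          (fun k => udiag W (map_mx (rpow p) (\row_i c k i i))).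
  apply/funext => k; rewrite -mpow_udiag //; congr mpow.
  by rewrite /udiag -cE conj_unitarymxKV.
apply: cvg_mulmx; last exact: cvg_cst.
apply: cvg_mulmx; first exact: cvg_cst.
apply: cvg_diag_mx; apply/cvg_mx_entries => i j.
under eq_fun do rewrite mxE; rewrite mxE; apply: cvg_rpow; rewrite ?ord1 //.
by move/cvg_mx_entries: rcl; apply.
Qed.

Lemma cvg_aluthge T : T \in unitmx -> T = U *m modulus S T ->
  (forall k l, comm_mx (iter k (fun X => U^t* *m X *m U) (modulus S T))
                       (iter l (fun X => U^t* *m X *m U) (modulus S T)))
  \/ r = 1 ->
  iter k (aluthge_cplx S (power_mean_fun r lambda)) T @[k --> \oo] -->
    U *m mpow S (conj_avg_limit (mpow S (modulus S T) r)) r^-1.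
Proof.
move=> Tu; have := modulus_posdef S Tu.
move: (modulus S T) => A pA -> comm_or.
(* For [r = 1], both powers in the limit are trivial; otherwise the disjunction provides the
   commutation. *)
have [r1|rN1] := eqVneq r 1.
  under eq_fun do rewrite (iter_aluthge1 S lambda01 r0 Uu _ r1 pA).
  rewrite r1 invr1 !mpow1 //; last exact: conj_avg_limit_posdef.
  by apply: cvg_mulmx; [exact: cvg_cst | exact: cvg_conj_avg].
case: comm_or => [comm|r1]; last by rewrite r1 eqxx in rN1.
have hA k : (iter k (fun X => U^t* *m X *m U) A)^t* =
            iter k (fun X => U^t* *m X *m U) A.
  by elim: k => [|k IH] /=; [exact: pA.1 | rewrite conj_unitarymx_herm IH].
have [W Wu WA] := codiagonalization_herm hA comm.
have cB := codiag_mpow S r Uu Wu pA WA.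
(* Puts the initial matrix in the form U B^(1/r) with B = A^r, on which the iteration acts by
   averaging B. *)
have AE : A = mpow S (mpow S A r) r^-1 by rewrite mpowM // divff // mpow1.
rewrite {1}AE.
under eq_fun do rewrite (iter_aluthge_codiag S lambda01 r0 Uu _ Wu cB).
apply: cvg_mulmx; first exact: cvg_cst.
exact: cvg_mpow_codiag Wu (mpow_posdef S r pA) cB.
Qed.

End ComplexLimits.

Lemma iter_conjE (C : numClosedFieldType) n (U A : 'M[C]_n) k :
  iter k (fun X => U^t* *m X *m U) A = (U^t*) ^+ k *m A *m U ^+ k.
Proof.
elim: k => [|k IH]; first by rewrite !expr0 mulmx1 mul1mx.
by rewrite iterS IH exprS exprSr !mulmxA.
Qed.

Local Open Scope complex_scope.

(** * The complex numbers as an instance of the abstract field *)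

Section ComplexNumbers.
Variable R : realType.
Implicit Types (x y : R) (z w : R[i]).

Lemma Re_gt0K z : 0 < z -> (complex.Re z)%:C = z.
Proof. by move=> z0; apply/RRe_real/gtr0_real. Qed.

Lemma normc_real x : `|x%:C| = `|x|%:C.
Proof. by rewrite normc_def /= expr0n addr0 sqrtr_sqr. Qed.

Lemma Re_sub z w : complex.Re (z - w) = complex.Re z - complex.Re w.
Proof. by case: z w => [a b] [c d]. Qed.

Lemma ler_normc_Re z : `|complex.Re z|%:C <= `|z|.
Proof.
by rewrite normc_def lecR -sqrtr_sqr ler_wsqrtr // lerDl sqr_ge0.
Qed.

Definition complex_complexification : complexification R R[i] :=
  @Build_complexification R R[i] (real_complex R) (@complex.Re R)
    (fun=> erefl) Re_gt0K (@ltcR R) normc_real Re_sub ler_normc_Re.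

End ComplexNumbers.

Lemma hadamard1mx (R : realType) (m : nat) (X : 'M[R[i]]_m) :
  hadamard 1%:M X = diag_mx (\row_i X i i).
Proof.
apply/matrixP=> i j; rewrite !mxE.
by case: eqVneq => [->|_]; rewrite ?mul1r ?mul0r.
Qed.

Theorem corollary8p2 (R : realType) (m : nat) (lambda r : R)
    (lambda01 : 0 < lambda < 1) (r11 : -1 <= r <= 1) (r0 : r != 0)
    (T U V : 'M[R[i]]_m) (alpha : 'I_m -> R[i])
    (Tunit : T \in unitmx)
    (Uunitary : U \is unitarymx) (polarT : T = U *m absmx T)
    (Vunitary : V \is unitarymx)
    (diagU : U = V ^t* *m diag_mx (\row_i alpha i) *m V)
    (alpha_neq : forall i j : 'I_m, i != j -> alpha i != alpha j)
    (Tcentered : centered T \/ r = 1) :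
  (fun n : nat => iter n (aluthge (power_mean_fun r lambda)) T) @ \oo -->
    U *m powmx (V ^t* *m
                hadamard 1%:M (V *m powmx (absmx T) r *m V ^t*) *m V) r^-1.
Proof.
have pA : posdefmx (absmx T).
  exact: (modulus_posdef (complex_complexification R) Tunit).
(* [centered] and [aluthge] use [polar_unitary T]; it is the given [U] because [absmx T] is
   invertible. *)
have polarE : polar_unitary T = U.
  by rewrite /polar_unitary {1}polarT mulmxK // posdefmx_unit.
have UE : U = udiag V (\row_i alpha i) by [].
have comm : (forall k l,
    comm_mx (iter k (fun X => U^t* *m X *m U) (absmx T))
            (iter l (fun X => U^t* *m X *m U) (absmx T))) \/ r = 1.
  case: Tcentered => [|->]; last by right.
  rewrite /centered polarE; set E := (_ `|` _) => cT; left.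
  have memE k : iter k (fun X => U^t* *m X *m U) (absmx T) \in E.
    (* The iterate 0 is |T| itself; the powers in [centered] start at 1. *)
    rewrite inE; case: k => [|k]; first by left; right.
    by left; left; exists k.+1; [| exact: iter_conjE].
  by move=> k l; exact: cT (memE k) (memE l).
have alphaN i j : i != j -> (\row_i alpha i) 0 i != (\row_i alpha i) 0 j.
  by move=> ij; rewrite !mxE alpha_neq.
have := @cvg_aluthge R R[i] (complex_complexification R) m lambda r U V
  (\row_i alpha i) lambda01 r0 Uunitary Vunitary UE alphaN T Tunit polarT comm.
rewrite /conj_avg_limit /udiag hadamard1mx.
(* [powmx], [absmx] and [aluthge] are convertible to the instances at [R[i]] of
   [mpow], [modulus] and [aluthge_cplx]. *)
exact.
Qed.
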